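(* Let $L\ge1$ be an integer, $\lambda_1,\dots,\lambda_L>0$, and assume that there exist $0\le\delta<c$ such that $c\le\lambda_x\le c+\delta$ for every $x=1,\dots,L$. For an integer $0\le N\le L$ consider the Bernoulli–Laplace process on $S_N=\{\eta\in\{0,1\}^L:\sum_x\eta_x=N\}$ with generator $$\mathcal{L}f(\eta)=\frac1L\sum_{x,y=1}^L\lambda_x\,\eta_x(1-\eta_y)\nabla_{xy}f(\eta)$$ and reversible measure $\pi=\pi_N$. Then for every $f:S_N\to(0,\infty)$ $$(c-\delta)\,\mathcal{E}(f,\log f)\le\pi\big[\mathcal{L}f\,\mathcal{L}\log f\big]+\pi\Big[\frac{(\mathcal{L}f)^2}{f}\Big],$$ and in particular $$(c-\delta)\,\mathrm{Ent}_\pi(f)\le\mathcal{E}(f,\log f).$$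
   Context: For $\eta\in\{0,1\}^L$ and $x\ne y$: if $\eta_x=1$ and $\eta_y=0$, then $\eta^{xy}$ is the configuration with $\eta^{xy}_x=0$, $\eta^{xy}_y=1$ and $\eta^{xy}_z=\eta_z$ for $z\ne x,y$; otherwise $\eta^{xy}=\eta$. $\nabla_{xy}f(\eta)=f(\eta^{xy})-f(\eta)$ (the terms $x=y$ vanish). The measure is $$\pi_N(\eta)=\frac1{Z_{L,N}}\prod_{x=1}^L\Big(\frac1{1+\lambda_x}\Big)^{\eta_x}\Big(\frac{\lambda_x}{1+\lambda_x}\Big)^{1-\eta_x},\qquad \eta\in S_N,$$ with $Z_{L,N}$ the normalization. $\pi[g]$ denotes expectation under $\pi$. $\mathcal{E}(f,g)=-\pi[f\mathcal{L}g]=\frac1{2L}\sum_{x,y}\pi[\lambda_x\eta_x(1-\eta_y)\nabla_{xy}f(\eta)\nabla_{xy}g(\eta)]$. $\mathrm{Ent}_\pi(f)=\pi[f\log f]-\pi[f]\log\pi[f]$. *)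

(* Defs.v *)
From HB Require Import structures.
From mathcomp Require Import all_boot all_order all_algebra.
From mathcomp Require Import reals exp.

Set Implicit Arguments.
Unset Strict Implicit.
Unset Printing Implicit Defensive.

Import Order.TTheory GRing.Theory Num.Theory.
Local Open Scope ring_scope.

Section Configurations.
Variable L : nat.

Definition config := {ffun 'I_L -> bool}.

Definition particles (eta : config) : nat := (\sum_(x < L) eta x)%N.

(* For x = y the test fails, so that [exchange eta x x = eta]. *)
Definition exchange (eta : config) (x y : 'I_L) : config :=
  if eta x && ~~ eta y then
    [ffun z => if z == x then false else if z == y then true else eta z]
  else eta.

Lemma particles_exchange (eta : config) (x y : 'I_L) :
  particles (exchange eta x y) = particles eta.
Proof.
rewrite /exchange; case: ifP => // /andP[ex ey].
have yx : y != x by apply/eqP => yx; rewrite yx ex in ey.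
rewrite /particles (bigD1 x) //= (bigD1 y) //= [RHS](bigD1 x) //=.
rewrite [in RHS](bigD1 y) //= !ffunE !eqxx (negbTE yx) ex (negbTE ey).
rewrite add0n; congr (_ + _)%N; rewrite add0n; apply: eq_bigr => z /andP[zx zy].
by rewrite ffunE (negbTE zx) (negbTE zy).
Qed.

Variable N : nat.

Definition stateSpace : finType :=
  {eta : config | particles eta == N}.

Lemma exchange_stateP (eta : stateSpace) (x y : 'I_L) :
  particles (exchange (val eta) x y) == N.
Proof. by rewrite particles_exchange; exact: valP eta. Qed.

Definition exchangeS (eta : stateSpace) (x y : 'I_L) : stateSpace :=
  exist _ (exchange (val eta) x y) (exchange_stateP eta x y).

End Configurations.

Section BernoulliLaplace.
Variables (R : realType) (L N : nat) (lambda : 'I_L -> R).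

Local Notation S_N := (stateSpace L N).

Implicit Types (f g : S_N -> R) (eta : S_N).

Definition occ eta (x : 'I_L) : nat := val eta x.

Definition grad (x y : 'I_L) f eta : R := f (exchangeS eta x y) - f eta.

Definition generator f eta : R :=
  L%:R^-1 * \sum_(x < L) \sum_(y < L)
    lambda x * (occ eta x)%:R * (1 - (occ eta y)%:R) * grad x y f eta.

Definition weight eta : R :=
  \prod_(x < L) ((1 / (1 + lambda x)) ^+ occ eta x *
                 (lambda x / (1 + lambda x)) ^+ (1 - occ eta x)).

Definition partition_function : R := \sum_(eta : S_N) weight eta.

Definition pi_N eta : R := partition_function^-1 * weight eta.

Definition pi_expect f : R := \sum_(eta : S_N) pi_N eta * f eta.

Definition dirichlet_form f g : R :=
  - pi_expect (fun eta => f eta * generator g eta).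

Definition entropy f : R :=
  pi_expect (fun eta => f eta * ln (f eta))
  - pi_expect f * ln (pi_expect f).

End BernoulliLaplace.

(* Main.v *)
Require Import Defs.
From HB Require Import structures.
From mathcomp Require Import all_boot all_order all_algebra.
From mathcomp Require Import reals exp.
From mathcomp Require Import ring lra.
From mathcomp Require Import boolp classical_sets topology normedtype derive.

Set Implicit Arguments.
Unset Strict Implicit.
Unset Printing Implicit Defensive.

Import Order.TTheory GRing.Theory Num.Theory.
Local Open Scope ring_scope.

(** The right-hand side of the first inequality is minus the derivative of
    the Dirichlet form [E(f, log f)] along the semigroup, so the inequality says
    that this form decays at rate [c - delta].  The proof is a coupling
    argument carried by the function [J(a,b) = (a - b)(ln a - ln b)], which is
    convex and homogeneous of degree one.

    Reversibility turns the Dirichlet form into a sum over configurations [xi]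
    with one particle less: with [F_x] the value of [f] after adding a particle
    at a hole [x] of [xi], it is
    [(1/2L) sum_xi w(xi) sum_(x,y holes of xi) J(F_x, F_y)], up to the
    normalization of the measure.  Its derivative pairs the partial derivative
    of [J] at [(F_x, F_y)] with [Lf] at [xi + x].  The moves out of [xi + x]
    are of three kinds.

    - The added particle jumps from [x] to a hole [v] of [xi], at rate
      [lambda_x].  For fixed [xi] this is one particle on the [M] holes of
      [xi], and the inequality is [one_particle_le]: the part [c] of
      [lambda_x] moves both [F_x] and [F_y] to their mean [m], where
      [J(m,m) = 0]; the excess [lambda_x - c <= delta] moves one of them only,
      and [M sum_y J(m,F_y) = (1/2) sum_(x,y) J(F_x,F_y)] bounds its
      cost.  The resulting rate is [(c - delta) M].
    - A particle [u] of [xi] jumps to [y].  The jump of [u] to [x] from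
      [xi + y] leads to the same configuration, so the pair merges.  The rate is the
      sum of [lambda_u], at least [(c - delta)(L - M)].
    - A particle [u] of [xi] jumps to a third hole [v], in both members of the
      pair.  The total effect is at most zero because these moves are
      reversible ([parallel_moves_cancel]).

    The three rates add up to [(c - delta) L], and [L] is cancelled by the
    factor [1/L] of the generator.  This is [cube_bochner].

    The entropy inequality follows from the first one for every finite
    irreducible reversible chain ([mlsi_of_bochner]).  Instead of integrating
    along the semigroup, one minimizes [E(g, log g) - k' Ent(g)], for
    [k' < c - delta], over the compact set of functions of a given mean with
    values in [[a, b]], [a > 0].  This set is stable under [g |-> g + t Lg] for
    small [t > 0], so the derivative in the direction [Lg] is nonnegative at a
    minimizer, while the first inequality bounds it by
    [(k' - (c - delta)) E(g, log g)].  Hence a minimizer is constant and the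
    minimum is zero. *)

(** * The convex function (a - b)(ln a - ln b) *)

Section ScalarConvexity.
Context {R : realType}.
Implicit Types a b : R.

Definition jeffreys a b : R := (a - b) * (ln a - ln b).

(** Partial derivative of [jeffreys] in its first variable; by symmetry,
    [jeffreysD b a] is the partial derivative in the second. *)
Definition jeffreysD a b : R := ln a - ln b + 1 - b / a.

Lemma jeffreys_diag a : jeffreys a a = 0.
Proof. by rewrite /jeffreys subrr mul0r. Qed.

Lemma jeffreysD_diag a : 0 < a -> jeffreysD a a = 0.
Proof. by move=> a0; rewrite /jeffreysD divff ?gt_eqF//; ring. Qed.

(** Euler's identity for a function homogeneous of degree one. *)
Lemma jeffreysD_euler a b : 0 < a -> 0 < b ->
  a * jeffreysD a b + b * jeffreysD b a = jeffreys a b.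
Proof.
by move=> a0 b0; rewrite /jeffreysD /jeffreys; field; rewrite !gt_eqF.
Qed.

(** Convexity of [x ln x], from [ln t <= t - 1] at [t = a / b]. *)
Lemma ln_sub_ge a b : 0 < a -> 0 < b -> b - a <= b * (ln b - ln a).
Proof.
move=> a0 b0; have ab0 : 0 < a / b by rewrite divr_gt0.
have : ln (1 + (a / b - 1)) <= a / b - 1 by apply: le_ln1Dx; lra.
rewrite addrC subrK ln_div ?posrE// => le1.
have := ler_wpM2l (ltW b0) le1.
have -> : b * (a / b - 1) = a - b by field; rewrite gt_eqF.
by lra.
Qed.

Lemma jeffreys_ge0 a b : 0 < a -> 0 < b -> 0 <= jeffreys a b.
Proof.
move=> a0 b0; have := ln_sub_ge a0 b0; have := ln_sub_ge b0 a0.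
by rewrite /jeffreys; lra.
Qed.

Lemma jeffreys_eq0 a b : 0 < a -> 0 < b -> jeffreys a b = 0 -> a = b.
Proof.
move=> a0 b0 /eqP; rewrite mulf_eq0 !subr_eq0 => /orP[/eqP//|/eqP].
by apply: ln_inj; rewrite posrE.
Qed.

(** A convex function lies above its tangent planes.  By homogeneity the tangent
    plane at [(a, b)] is linear in [(a', b')].  The difference of the two sides
    is a sum of two instances of [ln_sub_ge], for the pairs [(a b', a' b)] and
    [(a' b, a b')], whose first-order terms cancel. *)
Lemma jeffreys_tangent a b a' b' : 0 < a -> 0 < b -> 0 < a' -> 0 < b' ->
  a' * jeffreysD a b + b' * jeffreysD b a <= jeffreys a' b'.
Proof.
move=> a0 b0 a'0 b'0.
have := @ln_sub_ge (a * b') (a' * b) (mulr_gt0 a0 b'0) (mulr_gt0 a'0 b0).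
have := @ln_sub_ge (a' * b) (a * b') (mulr_gt0 a'0 b0) (mulr_gt0 a0 b'0).
rewrite !lnM ?posrE//.
set la := ln a; set lb := ln b; set la' := ln a'; set lb' := ln b' => le1 le2.
rewrite /jeffreysD /jeffreys -/la -/lb -/la' -/lb' -subr_ge0.
have -> : (a' - b') * (la' - lb')
   - (a' * (la - lb + 1 - b / a) + b' * (lb - la + 1 - a / b)) =
   (a' * b * (la' + lb - (la + lb')) - (a' * b - a * b')) / b +
   (a * b' * (la + lb' - (la' + lb)) - (a * b' - a' * b)) / a.
  by field; rewrite !gt_eqF.
by apply: addr_ge0; (apply: divr_ge0; [lra|exact: ltW]).
Qed.

Lemma jeffreys_tangent_sub a b a' b' : 0 < a -> 0 < b -> 0 < a' -> 0 < b' ->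
  jeffreysD a b * (a' - a) + jeffreysD b a * (b' - b) <= jeffreys a' b' - jeffreys a b.
Proof.
move=> a0 b0 a'0 b'0; have := jeffreys_tangent a0 b0 a'0 b'0.
by rewrite -(jeffreysD_euler a0 b0); lra.
Qed.

End ScalarConvexity.

(** * From decay of the Dirichlet form to the entropy inequality *)

(** Jumps are indexed by labels [m], from [s] to [act s m] at rate [rate s m];
    several labels may lead to the same state. *)
Section ReversibleChain.
Import numFieldNormedType.Exports.
Import ArrowAsProduct.
Local Open Scope classical_set_scope.
Context {R : realType} {T M : finType}.
Variables (act : T -> M -> T) (rate : T -> M -> R) (p : T -> R).

Hypothesis p_gt0 : forall s, 0 < p s.
Hypothesis p_sum1 : \sum_s p s = 1.
Hypothesis rate_ge0 : forall s m, 0 <= rate s m.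
Hypothesis reversible : forall F : T -> T -> R,
  \sum_s \sum_m p s * rate s m * F s (act s m) =
  \sum_s \sum_m p s * rate s m * F (act s m) s.
Hypothesis irreducible : forall g : T -> R,
  (forall s m, 0 < rate s m -> g (act s m) = g s) -> forall s s', g s = g s'.

Implicit Types f g : T -> R.

Definition chainGen g s : R := \sum_m rate s m * (g (act s m) - g s).

Definition chainDirichlet f : R :=
  - \sum_s p s * (f s * chainGen (fun s => ln (f s)) s).

Definition chainEntropy f : R :=
  \sum_s p s * (f s * ln (f s)) - (\sum_s p s * f s) * ln (\sum_s p s * f s).

(** Gradient of [chainDirichlet] at [g], as a density for [p]: it comes from
    differentiating [- p[Lg ln g]] and moving [L] across by self-adjointness.
    Thus [- sum_s p s * (chainGen g s * dirichletGrad g s)] is the quantity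
    [p[Lg L(ln g)] + p[(Lg)^2 / g]]. *)
Definition dirichletGrad g s : R :=
  - (chainGen (fun s => ln (g s)) s + chainGen g s / g s).

Lemma chainGen_mean0 g : \sum_s p s * chainGen g s = 0.
Proof.
have E (s : T) : p s * chainGen g s =
    \sum_m p s * rate s m * (g (act s m) - g s).
  by rewrite mulr_sumr; apply: eq_bigr => m _; rewrite mulrA.
rewrite (eq_bigr _ (fun s _ => E s)).
have := reversible (fun s s' => g s' - g s).
set X := (X in X = _ -> _).
have -> : \sum_s \sum_m p s * rate s m * (g s - g (act s m)) = - X.
  rewrite -sumrN; apply: eq_bigr => s _; rewrite -sumrN; apply: eq_bigr => m _.
  by ring.
by move=> ?; rewrite -/X; lra.
Qed.

Lemma chainGen_selfadjoint f g :
  \sum_s p s * (f s * chainGen g s) = \sum_s p s * (chainGen f s * g s).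
Proof.
have E1 (s : T) : p s * (f s * chainGen g s) =
    \sum_m p s * rate s m * (f s * g (act s m)) - \sum_m p s * rate s m * (f s * g s).
  rewrite -sumrB /chainGen !mulr_sumr; apply: eq_bigr => m _; ring.
have E2 (s : T) : p s * (chainGen f s * g s) =
    \sum_m p s * rate s m * (f (act s m) * g s) - \sum_m p s * rate s m * (f s * g s).
  rewrite -sumrB /chainGen mulr_suml mulr_sumr; apply: eq_bigr => m _; ring.
rewrite (eq_bigr _ (fun s _ => E1 s)) (eq_bigr _ (fun s _ => E2 s)) !sumrB.
by rewrite (reversible (fun s s' => f s * g s')).
Qed.

Lemma dirichletGradE f g : (forall s, 0 < g s) ->
  \sum_s p s * (f s * dirichletGrad g s) =
  \sum_s \sum_m p s * rate s m * (f s * jeffreysD (g s) (g (act s m))).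
Proof.
move=> g0; apply: eq_bigr => s _.
rewrite /dirichletGrad /chainGen [X in _ + X]mulr_suml -big_split/= -sumrN.
rewrite !mulr_sumr; apply: eq_bigr => m _.
by rewrite /jeffreysD; field; rewrite gt_eqF.
Qed.

Lemma dirichletGrad_self f : (forall s, 0 < f s) ->
  \sum_s p s * (f s * dirichletGrad f s) = chainDirichlet f.
Proof.
move=> f0; have E (s : T) : p s * (f s * dirichletGrad f s) =
    - (p s * (f s * chainGen (fun s => ln (f s)) s)) - p s * chainGen f s.
  by rewrite /dirichletGrad; field; rewrite gt_eqF.
by rewrite (eq_bigr _ (fun s _ => E s)) sumrB chainGen_mean0 subr0 sumrN.
Qed.

Lemma dirichletGrad_symm f g : (forall s, 0 < g s) ->
  \sum_s p s * (f s * dirichletGrad g s) =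
  2^-1 * \sum_s \sum_m p s * rate s m *
    (f s * jeffreysD (g s) (g (act s m)) + f (act s m) * jeffreysD (g (act s m)) (g s)).
Proof.
move=> g0; rewrite dirichletGradE//.
have rev := reversible (fun s s' => f s * jeffreysD (g s) (g s')).
have half (X : R) : X = 2^-1 * (X + X) by field.
rewrite [LHS]half [X in _ + X]rev -big_split; congr (_ * _).
apply: eq_bigr => s _; rewrite -big_split; apply: eq_bigr => m _ /=.
by ring.
Qed.

Lemma chainDirichletE f : (forall s, 0 < f s) ->
  chainDirichlet f =
  2^-1 * \sum_s \sum_m p s * rate s m * jeffreys (f s) (f (act s m)).
Proof.
move=> f0; rewrite -dirichletGrad_self// dirichletGrad_symm//; congr (_ * _).
apply: eq_bigr => s _; apply: eq_bigr => m _.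
by rewrite jeffreysD_euler.
Qed.

(** Convexity of the Dirichlet form [f |-> E(f, ln f)], inherited from
    [jeffreys_tangent]; it is homogeneous of degree one as well, whence the linear
    lower bound. *)
Lemma dirichletGrad_le f g : (forall s, 0 < f s) -> (forall s, 0 < g s) ->
  \sum_s p s * (f s * dirichletGrad g s) <= chainDirichlet f.
Proof.
move=> f0 g0; rewrite chainDirichletE// dirichletGrad_symm//.
apply: ler_wpM2l; first by rewrite invr_ge0.
apply: ler_sum => s _; apply: ler_sum => m _.
by apply: ler_wpM2l; [rewrite mulr_ge0// ltW|exact: jeffreys_tangent].
Qed.

Lemma chainDirichlet_ge0 f : (forall s, 0 < f s) -> 0 <= chainDirichlet f.
Proof.
move=> f0; rewrite chainDirichletE// mulr_ge0 ?invr_ge0//.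
apply: sumr_ge0 => s _; apply: sumr_ge0 => m _.
by apply: mulr_ge0; rewrite ?jeffreys_ge0// mulr_ge0// ltW.
Qed.

Lemma chainDirichlet_le0_const f : (forall s, 0 < f s) ->
  chainDirichlet f <= 0 -> forall s s', f s = f s'.
Proof.
move=> f0 E0; apply: irreducible => s m r0; apply/esym/jeffreys_eq0 => //.
have t0 s' m' : 0 <= p s' * rate s' m' * jeffreys (f s') (f (act s' m')).
  by apply: mulr_ge0; rewrite ?jeffreys_ge0// mulr_ge0// ltW.
have : \sum_s \sum_m p s * rate s m * jeffreys (f s) (f (act s m)) <= 0.
  by move: E0; rewrite chainDirichletE// pmulr_rle0// invr_gt0.
rewrite le_eqVlt ltNge sumr_ge0 ?orbF => [/eqP/psumr_eq0P|s' _]; last first.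
  by rewrite sumr_ge0.
move=> /(_ (fun s' _ => sumr_ge0 _ (fun m' _ => t0 s' m')) s isT)/psumr_eq0P.
move=> /(_ (fun m' _ => t0 s m') m isT)/eqP.
by rewrite mulf_eq0 (gt_eqF (mulr_gt0 (p_gt0 s) r0)) => /eqP.
Qed.

Lemma chainEntropy_const f : (forall s s', f s = f s') -> chainEntropy f = 0.
Proof.
move=> fc; case: (pickP (@predT T)) => [s0 _|T0]; last first.
  by rewrite /chainEntropy !big_pred0// mul0r subr0.
have -> : f = fun=> f s0 by apply/funext => s; exact: fc.
by rewrite /chainEntropy -!mulr_suml p_sum1 !mul1r subrr.
Qed.

Definition eulerStep t g s : R := g s + t * chainGen g s.

Lemma euler_mean t g : \sum_s p s * eulerStep t g s = \sum_s p s * g s.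
Proof.
transitivity (\sum_s p s * g s + t * \sum_s p s * chainGen g s); last first.
  by rewrite chainGen_mean0 mulr0 addr0.
rewrite mulr_sumr -big_split; apply: eq_bigr => s _.
by rewrite /eulerStep/=; ring.
Qed.

(** For small [t] the Euler step averages the values of [g] with nonnegative
    weights, so it preserves bounds. *)
Lemma euler_bounds (a b t : R) g : 0 <= t ->
  (forall s, t * \sum_m rate s m <= 1) ->
  (forall s, a <= g s <= b) -> forall s, a <= eulerStep t g s <= b.
Proof.
move=> t0 t1 gab s.
have E x : eulerStep t g s - x = (1 - t * \sum_m rate s m) * (g s - x) +
   t * \sum_m rate s m * (g (act s m) - x).
  have -> : \sum_m rate s m * (g (act s m) - x) =
     \sum_m rate s m * (g (act s m) - g s) + (\sum_m rate s m) * (g s - x).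
    by rewrite mulr_suml -big_split; apply: eq_bigr => m _ /=; ring.
  by rewrite /eulerStep /chainGen; ring.
have c0 : 0 <= 1 - t * \sum_m rate s m by rewrite subr_ge0.
apply/andP; split; rewrite -subr_ge0.
  rewrite E addr_ge0 ?mulr_ge0 ?sumr_ge0// => [|m _].
    by rewrite subr_ge0; case/andP: (gab s).
  by rewrite mulr_ge0// subr_ge0; case/andP: (gab (act s m)).
rewrite -opprB oppr_ge0 E -[leRHS]addr0 lerD//.
  by rewrite mulr_ge0_le0// subr_le0; case/andP: (gab s).
rewrite mulr_ge0_le0// sumr_le0// => m _.
by rewrite mulr_ge0_le0// subr_le0; case/andP: (gab (act s m)).
Qed.

(** The entropy lies above its tangent at [g], whose slope in the direction
    [Lg] is [p[Lg ln g] = - E(g, ln g)]. *)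
Lemma chainEntropy_euler t g : (forall s, 0 < g s) ->
  (forall s, 0 < eulerStep t g s) ->
  chainEntropy g - t * chainDirichlet g <= chainEntropy (eulerStep t g).
Proof.
move=> g0 e0; rewrite /chainEntropy euler_mean.
suff : \sum_s p s * (g s * ln (g s)) - t * chainDirichlet g
   <= \sum_s p s * (eulerStep t g s * ln (eulerStep t g s)) by lra.
rewrite /chainDirichlet chainGen_selfadjoint mulrN opprK.
apply: (@le_trans _ _ (\sum_s p s * (g s * ln (g s)) +
    t * (\sum_s p s * (chainGen g s * ln (g s))) + t * \sum_s p s * chainGen g s)).
  by rewrite chainGen_mean0 mulr0 addr0.
rewrite !mulr_sumr -!big_split; apply: ler_sum => s _ /=.
have := ler_wpM2l (ltW (p_gt0 s)) (ln_sub_ge (g0 s) (e0 s)).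
by rewrite /eulerStep; lra.
Qed.


Definition defect k f : R := chainDirichlet f - k * chainEntropy f.

Lemma cvg_ln (S : Type) (F : set_system S) {FF : Filter F} (h : S -> R) (a : R) :
  0 < a -> h @ F --> a -> (fun s => ln (h s)) @ F --> ln a.
Proof. by move=> a0 ha; apply: (cvg_comp _ _ ha); exact: continuous_ln. Qed.

Lemma cvg_sumr (S : Type) (F : set_system S) {FF : Filter F} (I : finType)
    (h : I -> S -> R) (a : I -> R) :
  (forall i, h i @ F --> a i) -> (fun s => \sum_i h i s) @ F --> \sum_i a i.
Proof. by move=> ha; apply: cvg_big => //; exact: add_continuous. Qed.

Lemma cvg_chainGen (S : Type) (F : set_system S) {FF : Filter F}
    (h : S -> T -> R) g s :
  (forall s', h x s' @[x --> F] --> g s') ->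
  chainGen (h x) s @[x --> F] --> chainGen g s.
Proof.
move=> hg; apply: cvg_sumr => m; apply: cvgM; first exact: cvg_cst.
by apply: cvgB; exact: hg.
Qed.

Lemma cvg_defect (S : Type) (F : set_system S) {FF : Filter F}
    (h : S -> T -> R) k g : (forall s, 0 < g s) ->
  (forall s, h x s @[x --> F] --> g s) ->
  defect k (h x) @[x --> F] --> defect k g.
Proof.
move=> g0 hg.
have hl s : ln (h x s) @[x --> F] --> ln (g s) by exact: cvg_ln.
have [s0 _|T0] := pickP (@predT T); last first.
  rewrite (_ : h = fun=> g) ?funeqE; first exact: cvg_cst.
  by move=> x; apply/funext => s; have := T0 s.
have m0 : 0 < \sum_s p s * g s.
  rewrite (bigD1 s0)//= ltr_pwDl ?mulr_gt0// sumr_ge0// => s _.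
  by rewrite mulr_ge0 ?ltW.
have hm : \sum_s p s * h x s @[x --> F] --> \sum_s p s * g s.
  by apply: cvg_sumr => s; apply: cvgM => //; exact: cvg_cst.
apply: cvgB.
  apply: cvgN; apply: cvg_sumr => s; apply: cvgM; first exact: cvg_cst.
  by apply: cvgM; [exact: hg|exact: cvg_chainGen].
apply: cvgM; first exact: cvg_cst.
apply: cvgB; last by apply: cvgM => //; exact: cvg_ln.
apply: cvg_sumr => s; apply: cvgM; first exact: cvg_cst.
by apply: cvgM; [exact: hg|exact: hl].
Qed.

Lemma cvg_dirichletGrad (S : Type) (F : set_system S) {FF : Filter F}
    (h : S -> T -> R) g s : (forall s, 0 < g s) ->
  (forall s', h x s' @[x --> F] --> g s') ->
  dirichletGrad (h x) s @[x --> F] --> dirichletGrad g s.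
Proof.
move=> g0 hg; apply: cvgN; apply: cvgD.
  by apply: cvg_chainGen => s'; exact: cvg_ln.
apply: cvgM; first exact: cvg_chainGen.
by apply: cvgV; [rewrite gt_eqF|exact: hg].
Qed.

(** Convexity bounds the increment of the Dirichlet form by its gradient at the
    end point of the step, and the increment of the entropy by its gradient at
    the starting point. *)
Lemma euler_defect_le k t g : 0 <= k -> (forall s, 0 < g s) ->
  (forall s, 0 < eulerStep t g s) ->
  defect k (eulerStep t g) <= defect k g +
    t * (\sum_s p s * (chainGen g s * dirichletGrad (eulerStep t g) s) +
         k * chainDirichlet g).
Proof.
move=> k0 g0 e0.
have E1 := dirichletGrad_le g0 e0.
have E2 := dirichletGrad_self e0.
have E3 := ler_wpM2l k0 (chainEntropy_euler g0 e0).
have E4 : \sum_s p s * (eulerStep t g s * dirichletGrad (eulerStep t g) s) =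
   \sum_s p s * (g s * dirichletGrad (eulerStep t g) s) +
   t * \sum_s p s * (chainGen g s * dirichletGrad (eulerStep t g) s).
  rewrite mulr_sumr -big_split; apply: eq_bigr => s _ /=.
  by rewrite {1}/eulerStep; ring.
by rewrite /defect; lra.
Qed.

(** The minimum is taken over the functions with the mean of [f] and values in
    [[a, b]], a compact set that contains [f] and, by [euler_bounds], all small
    Euler steps from its points.  The bound [a > 0] keeps the logarithm
    continuous there. *)
Lemma defect_min k f : (forall s, 0 < f s) -> exists2 g, forall s, 0 < g s &
  defect k g <= defect k f /\
  \forall t \near 0^'+, forall s, 0 < eulerStep t g s /\
     defect k g <= defect k (eulerStep t g).
Proof.
move=> f0.
(* Positive terms are bounded by their sum, for [f] and for its inverse. *)
pose a : R := (\sum_s (f s)^-1)^-1; pose b : R := \sum_s f s.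
pose m := \sum_s p s * f s.
have fab s : a <= f s <= b.
  apply/andP; split; last first.
    rewrite /b (bigD1 s)//= lerDl; apply: sumr_ge0 => s' _; exact: ltW.
  rewrite /a invf_ple ?posrE//.
    rewrite (bigD1 s)//= lerDl; apply: sumr_ge0 => s' _.
    by rewrite invr_ge0 ltW.
  rewrite (bigD1 s)//= ltr_pwDl ?invr_gt0//; apply: sumr_ge0 => s' _.
  by rewrite invr_ge0 ltW.
have a0 (s : T) : 0 < a.
  rewrite invr_gt0 (bigD1 s)//= ltr_pwDl ?invr_gt0//; apply: sumr_ge0 => s' _.
  by rewrite invr_ge0 ltW.
pose K : set (T -> R) := [set g | forall s, `[a, b] (g s)] `&`
   [set g | \sum_s p s * g s = m].
have pc s : continuous (fun g : T -> R => g s) by exact: proj_continuous.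
have cm : continuous (fun g : T -> R => \sum_s p s * g s).
  move=> g; apply: (@cvg_sumr (T -> R) (nbhs g) _ T (fun s g => p s * g s)) => s.
  by apply: cvgM; [exact: cvg_cst|exact: pc].
have cK : compact K.
  apply: compact_closedI.
    by apply: (@tychonoff T (fun=> R) (fun=> `[a, b])) => s; exact: segment_compact.
  apply: (@preimage_closed _ _ (fun g : T -> R => \sum_s p s * g s) [set m]).
    by move=> g _; exact: cm.
  exact: closed_eq.
have Kf : K f by split => //= s; rewrite in_itv/= fab.
have Kpos g : K g -> forall s, 0 < g s.
  move=> [+ _] s => /(_ s)/=; rewrite in_itv/= => /andP[ag _].
  exact: lt_le_trans (a0 s) ag.
have cD : {within K, continuous (defect k)}.
  apply: continuous_in_subspaceT => g /set_mem Kg.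
  apply: (@cvg_defect (T -> R) (nbhs g) _ (fun g => g)) => [|s]; first exact: Kpos.
  exact: pc.
have [|g /set_mem Kg gmin] := compact_EVT_min _ cK cD; first by exists f.
exists g; first exact: Kpos.
split; first by apply: gmin; exact/mem_set.
have : \forall t \near 0^'+, t * (1 + \sum_s \sum_m rate s m) <= 1 :> R.
  have c0 : 0 < 1 + \sum_s \sum_m rate s m.
    by rewrite ltr_pwDl// sumr_ge0// => s _; rewrite sumr_ge0.
  near=> t; rewrite -ler_pdivlMr//; near: t.
  by apply: nbhs_right_le; rewrite divr_gt0.
move=> near1; near=> t.
have t0 : 0 < t by near: t; exact: nbhs_right_gt.
have t1 : t * (1 + \sum_s \sum_m rate s m) <= 1 by near: t.
have Kt : K (eulerStep t g).
  split; last by rewrite /= euler_mean; case: Kg.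
  move=> s /=; rewrite in_itv/=; apply: euler_bounds; first exact: ltW.
    move=> s'; apply: le_trans t1; apply: ler_wpM2l; first exact: ltW.
    rewrite (bigD1 s')//= addrCA lerDl addr_ge0//.
    by apply: sumr_ge0 => s'' _; apply: sumr_ge0 => ? _.
  by move=> s'; case: Kg => + _ => /(_ s')/=; rewrite in_itv.
move=> s; split; first exact: Kpos.
by apply: gmin; exact/mem_set.
Unshelve. all: by end_near. Qed.


(** The constants [k' < k] give room: at a minimizer [g] of [defect k'] the
    slope in the direction [Lg] is both nonnegative and at most
    [(k' - k) E(g, ln g)], which forces [E(g, ln g) = 0]. *)
Theorem mlsi_of_bochner k : 0 <= k ->
  (forall g, (forall s, 0 < g s) ->
    k * chainDirichlet g <=
    - \sum_s p s * (chainGen g s * dirichletGrad g s)) ->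
  forall f, (forall s, 0 < f s) -> k * chainEntropy f <= chainDirichlet f.
Proof.
move=> k_ge0 bochner f f0.
suff below k' : 0 <= k' -> k' < k -> k' * chainEntropy f <= chainDirichlet f.
  have E0 := chainDirichlet_ge0 f0.
  have [Ent0|Ent0] := leP (chainEntropy f) 0.
    by apply: le_trans E0; rewrite mulr_ge0_le0// ltW.
  rewrite -ler_pdivlMr//; apply/ler_addgt0Pl => e e0.
  have [ek|ke] := leP e k; last first.
    by rewrite (le_trans (ltW ke))// lerDl divr_ge0// ltW.
  rewrite -lerBlDl ler_pdivlMr//; apply: below; lra.
move=> k'0 k'k; have [g g0 [gf gmin]] := defect_min k' f0.
suff Eg0 : chainDirichlet g <= 0.
  have := chainDirichlet_le0_const g0 Eg0 => /chainEntropy_const Ent0.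
  have := chainDirichlet_ge0 g0.
  by move: gf; rewrite /defect Ent0 mulr0; lra.
suff slope : 0 <= \sum_s p s * (chainGen g s * dirichletGrad g s)
                  + k' * chainDirichlet g.
  have := bochner g g0 => Bg.
  have : 0 <= (k' - k) * chainDirichlet g by lra.
  by rewrite nmulr_rge0// subr_lt0.
pose slope t := \sum_s p s * (chainGen g s * dirichletGrad (eulerStep t g) s)
   + k' * chainDirichlet g.
have cvslope : slope t @[t --> 0^'+] --> \sum_s p s * (chainGen g s * dirichletGrad g s)
   + k' * chainDirichlet g.
  apply: cvgD; last exact: cvg_cst.
  apply: cvg_sumr => s; apply: cvgM; first exact: cvg_cst.
  apply: cvgM; first exact: cvg_cst.
  apply: cvg_dirichletGrad => // s'.
  have -> : g s' = g s' + 0 * chainGen g s' by rewrite mul0r addr0.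
  apply: cvgD; first exact: cvg_cst.
  apply: cvgM; last exact: cvg_cst.
  by apply: cvg_at_right_filter; exact: cvg_id.
rewrite leNgt; apply/negP => slope0.
have [t [t0 gt st]] : exists t, [/\ 0 < t, forall s, 0 < eulerStep t g s /\
     defect k' g <= defect k' (eulerStep t g) & slope t < 0].
  near (0:R)^'+ => t; exists t; split; near: t.
  - exact: nbhs_right_gt.
  - exact: gmin.
  - exact: (cvgr_lt _ cvslope).
have [s0 _|T0] := pickP (@predT T); last first.
  by move: slope0; rewrite /chainDirichlet !big_pred0// oppr0 mulr0 addr0 ltxx.
have e0 s : 0 < eulerStep t g s by case: (gt s).
have := euler_defect_le k'0 g0 e0; rewrite -/(slope t).
have [_ le1] := gt s0 => le2.
have : 0 <= t * slope t by lra.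
by rewrite pmulr_rge0// leNgt st.
Unshelve. all: by end_near. Qed.

End ReversibleChain.

(** * Coupling bounds on a finite set of sites *)

Section CoupledPairs.
Context {R : realType} {I : finType}.
Implicit Types (P : pred I) (a : I -> R).

Definition pairForm P a : R := \sum_(x | P x) \sum_(y | P y) jeffreys (a x) (a y).

Lemma pairForm_ge0 P a : (forall x, 0 < a x) -> 0 <= pairForm P a.
Proof.
by move=> a0; apply: sumr_ge0 => x _; apply: sumr_ge0 => y _; exact: jeffreys_ge0.
Qed.

(** If [a x] and [a y] are replaced by [a' x y] and [a' y x], the first-order
    change of the pair form is at most its actual change; this is where
    [x] and [y] are moved simultaneously. *)
Lemma coupling_le P a (a' : I -> I -> R) :
  (forall x, 0 < a x) -> (forall x y, 0 < a' x y) ->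
  \sum_(x | P x) \sum_(y | P y) jeffreysD (a x) (a y) * (a' x y - a x) <=
  2^-1 * ((\sum_(x | P x) \sum_(y | P y) jeffreys (a' x y) (a' y x)) - pairForm P a).
Proof.
move=> a0 a'0; set X := (X in X <= _).
have half (Y : R) : Y = 2^-1 * (Y + Y) by field.
rewrite [leLHS]half {2}/X exchange_big /X -big_split -sumrB.
apply: ler_wpM2l; first by rewrite invr_ge0.
apply: ler_sum => x _; rewrite -big_split -sumrB; apply: ler_sum => y _ /=.
exact: jeffreys_tangent_sub.
Qed.

Lemma pairForm_mean P a :
  pairForm P a = 2 * ((\sum_(x | P x) 1) * (\sum_(x | P x) a x * ln (a x)) -
   (\sum_(x | P x) a x) * (\sum_(x | P x) ln (a x))).
Proof.
have -> : pairForm P a = \sum_(x | P x) \sum_(y | P y)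
   ((a x * ln (a x)) * 1 + 1 * (a y * ln (a y)) - a x * ln (a y) - ln (a x) * a y).
  by apply: eq_bigr => x _; apply: eq_bigr => y _; rewrite /jeffreys; ring.
have prodE (b d : I -> R) : \sum_(x | P x) \sum_(y | P y) b x * d y =
   (\sum_(x | P x) b x) * (\sum_(y | P y) d y).
  by rewrite mulr_suml; apply: eq_bigr => x _; rewrite mulr_sumr.
under eq_bigr do rewrite !sumrB big_split/=.
rewrite !sumrB big_split/= !prodE; ring.
Qed.

(** With [m] the mean of [a] and [n] the number of sites, the drift of
    [a x] is [lam x * n * (m - a x)].  The part [c] of [lam x] is a coupling that sends
    both sites to [m].  For the excess, moving only one site,
    [J_1(a_x,a_y)(m - a_x) <= J(m,a_y) - J(a_x,a_y) <= J(m,a_y)]. *)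
Lemma one_particle_le P a (lam : I -> R) (c delta : R) :
  (forall x, 0 < a x) -> 0 <= c -> 0 <= delta ->
  (forall x, c <= lam x <= c + delta) ->
  \sum_(x | P x) \sum_(y | P y) jeffreysD (a x) (a y) *
     (lam x * \sum_(v | P v) (a v - a x)) <=
  - ((c - delta) / 2 * (\sum_(x | P x) 1) * pairForm P a).
Proof.
move=> a0 c0 d0 lamb.
have [x0 Px0|P0] := pickP P; last first.
  by rewrite /pairForm !big_pred0// mulr0 oppr0.
pose n : R := \sum_(x | P x) 1.
have n0 : 0 < n by rewrite /n (bigD1 x0)//= ltr_pwDl// sumr_ge0.
pose m := (\sum_(x | P x) a x) / n.
have m0 : 0 < m.
  rewrite divr_gt0// (bigD1 x0)//= ltr_pwDl// sumr_ge0// => x _; exact: ltW.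
have sumE x : \sum_(v | P v) (a v - a x) = n * (m - a x).
  rewrite sumrB mulrBr /m mulrCA divff ?gt_eqF// mulr1 /n mulr_suml.
  by under [X in _ = _ - X]eq_bigr do rewrite mul1r.
(* Spreading around the mean accounts for all the pairs. *)
have hm : n * (\sum_(y | P y) jeffreys m (a y)) = 2^-1 * pairForm P a.
  have -> : \sum_(y | P y) jeffreys m (a y) =
     ln m * n * m - ln m * (\sum_(y | P y) a y) - m * (\sum_(y | P y) ln (a y))
     + \sum_(y | P y) a y * ln (a y).
    rewrite /n 2!mulr_sumr !mulr_suml mulr_sumr -!sumrB -big_split.
    by apply: eq_bigr => y _; rewrite /jeffreys /=; ring.
  rewrite pairForm_mean -/n /m; field; rewrite gt_eqF//.
have step x y : jeffreysD (a x) (a y) * (lam x * \sum_(v | P v) (a v - a x)) <=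
    n * c * (jeffreysD (a x) (a y) * (m - a x)) + n * delta * jeffreys m (a y).
  rewrite sumE; have /andP[cl lc] := lamb x.
  have le1 : jeffreysD (a x) (a y) * (m - a x) <= jeffreys m (a y).
    have := jeffreys_tangent_sub (a0 x) (a0 y) m0 (a0 y).
    have := jeffreys_ge0 (a0 x) (a0 y); rewrite subrr mulr0; lra.
  have le2 := jeffreys_ge0 m0 (a0 y).
  have : (lam x - c) * (jeffreysD (a x) (a y) * (m - a x)) <= delta * jeffreys m (a y).
    apply: le_trans (_ : (lam x - c) * jeffreys m (a y) <= _).
      by apply: ler_wpM2l => //; rewrite subr_ge0.
    by apply: ler_wpM2r => //; lra.
  move=> /(ler_wpM2l (ltW n0)); lra.
apply: le_trans (ler_sum _ (fun x _ => ler_sum _ (fun y _ => step x y))) _.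
under eq_bigr do rewrite big_split/= -!mulr_sumr.
rewrite big_split/= -!mulr_sumr.
have := @coupling_le P a (fun _ _ => m) a0 (fun _ _ => m0).
have -> : \sum_(x | P x) \sum_(y | P y) jeffreys m m = 0.
  by rewrite big1// => x _; rewrite big1// => y _; rewrite jeffreys_diag.
rewrite sub0r => /(ler_wpM2l (mulr_ge0 (ltW n0) c0)) le1.
have -> : \sum_(x | P x) \sum_(y | P y) jeffreys m (a y) = 2^-1 * pairForm P a.
  by rewrite -hm /n mulr_suml; under [RHS]eq_bigr do rewrite mul1r.
by rewrite -/n; lra.
Qed.

End CoupledPairs.

(** * Decay of the Dirichlet form on the cube of configurations *)

Section Flip.
Context {L : nat}.
Implicit Types (eta xi : config L) (x y z : 'I_L).

(** Adding and removing a particle are the same involution, and flips at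
    different sites commute; this makes changes of variables in sums over
    configurations immediate. *)
Definition flip x eta : config L := [ffun z => if z == x then ~~ eta z else eta z].

Lemma flip_self x eta : flip x eta x = ~~ eta x.
Proof. by rewrite ffunE eqxx. Qed.

Lemma flip_neq x z eta : z != x -> flip x eta z = eta z.
Proof. by move=> zx; rewrite ffunE (negbTE zx). Qed.

Lemma flipK x : involutive (flip x).
Proof. by move=> eta; apply/ffunP => z; rewrite !ffunE; case: eqP; rewrite ?negbK. Qed.

Lemma flipC x y eta : flip x (flip y eta) = flip y (flip x eta).
Proof.
by apply/ffunP => z; rewrite !ffunE; case: (z == x); case: (z == y).
Qed.

Lemma exchange_flip eta x y : eta x -> ~~ eta y ->
  exchange eta x y = flip y (flip x eta).
Proof.
move=> ex ey; rewrite /exchange ex ey/=; apply/ffunP => z; rewrite !ffunE.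
have [->|zx] := eqVneq z x; last by have [->|//] := eqVneq z y; rewrite ey.
by rewrite ex; case: eqP ey => // <-; rewrite ex.
Qed.

End Flip.

(** Particle numbers are conserved, so it is harmless to sum over all the
    configurations at once: a function that is constant on the other sectors
    gets no contribution from them. *)
Section Cube.
Context {R : realType} {L : nat}.
Variable lambda : 'I_L -> R.
Hypothesis lambda_gt0 : forall x, 0 < lambda x.
Implicit Types (eta xi zeta : config L) (f : config L -> R) (x y u v : 'I_L).

Definition cubeWeight eta : R :=
  \prod_(x < L) ((1 / (1 + lambda x)) ^+ eta x *
                 (lambda x / (1 + lambda x)) ^+ (1 - eta x)).

Lemma lambda1_gt0 x : 0 < 1 + lambda x.
Proof. by rewrite ltr_pwDl// ltW. Qed.

Lemma cubeWeight_gt0 eta : 0 < cubeWeight eta.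
Proof.
apply: prodr_gt0 => x _; have l1 := lambda1_gt0 x.
by apply: mulr_gt0; apply: exprn_gt0; apply: divr_gt0.
Qed.

Lemma cubeWeight_flip x xi : ~~ xi x ->
  cubeWeight (flip x xi) * lambda x = cubeWeight xi.
Proof.
move=> xx; rewrite /cubeWeight (bigD1 x)//= [RHS](bigD1 x)//= flip_self.
rewrite (negbTE xx)/= [X in _ * X * _ = _](eq_bigr (fun z =>
    (1 / (1 + lambda z)) ^+ xi z * (lambda z / (1 + lambda z)) ^+ (1 - xi z))).
  by rewrite !expr1 !expr0; field; rewrite gt_eqF ?lambda1_gt0.
by move=> z zx; rewrite flip_neq.
Qed.

(** Change of variables from a configuration with a marked particle to the
    configuration without it: the weight absorbs [lambda x]. *)
Lemma sum_particles (G : config L -> 'I_L -> R) :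
  \sum_(eta : config L) \sum_(x | eta x) cubeWeight eta * lambda x * G eta x =
  \sum_(xi : config L) \sum_(x | ~~ xi x) cubeWeight xi * G (flip x xi) x.
Proof.
rewrite (exchange_big_dep xpredT)//= [RHS](exchange_big_dep xpredT)//=.
apply: eq_bigr => x _; rewrite (reindex_inj (can_inj (flipK x)))/=.
apply: eq_big => [xi|xi]; first by rewrite flip_self.
by rewrite flip_self => xx; rewrite cubeWeight_flip.
Qed.

Lemma sum_holes_flip x xi (G : 'I_L -> R) : ~~ xi x ->
  \sum_(y | ~~ flip x xi y) G y = \sum_(y | ~~ xi y && (y != x)) G y.
Proof.
move=> xx; apply: eq_bigl => y; have [->|yx] := eqVneq y x.
  by rewrite flip_self xx andbF.
by rewrite flip_neq// andbT.
Qed.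

Lemma sum_offdiag (P : pred 'I_L) x (G : 'I_L -> R) : G x = 0 ->
  \sum_(y | P y && (y != x)) G y = \sum_(y | P y) G y.
Proof.
move=> G0; rewrite [RHS](bigID (fun y => y == x))/= [X in _ = X + _]big1 ?add0r//.
by move=> y /andP[_ /eqP ->].
Qed.

(** The reversibility of the dynamics: both end points of a jump are obtained by
    adding a particle to a common configuration [xi], and the right-hand side
    gives them symmetric roles.  On the left a particle never jumps to its own
    site, on the right [x = y] occurs, whence the condition on [G]. *)
Lemma sum_jumps (G : config L -> config L -> R) : (forall zeta, G zeta zeta = 0) ->
  \sum_(eta : config L) \sum_(x | eta x) \sum_(y | ~~ eta y)
    cubeWeight eta * lambda x * G eta (flip y (flip x eta)) =
  \sum_(xi : config L) cubeWeight xi *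
    \sum_(x | ~~ xi x) \sum_(y | ~~ xi y) G (flip x xi) (flip y xi).
Proof.
move=> G0; under eq_bigr do under eq_bigr do rewrite -mulr_sumr.
rewrite (sum_particles (fun eta x =>
  \sum_(y | ~~ eta y) G eta (flip y (flip x eta)))).
apply: eq_bigr => xi _; rewrite mulr_sumr; apply: eq_bigr => x xx.
congr (_ * _); rewrite sum_holes_flip//; under eq_bigr do rewrite flipK.
by rewrite (@sum_offdiag _ _ (fun y => G (flip x xi) (flip y xi))).
Qed.

Definition cubeGen f eta : R :=
  L%:R^-1 * \sum_(x | eta x) \sum_(y | ~~ eta y)
    lambda x * (f (flip y (flip x eta)) - f eta).

Definition addForm f xi : R := pairForm (fun x => ~~ xi x) (fun x => f (flip x xi)).

Definition cubeDirichlet f : R :=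
  - \sum_(eta : config L) cubeWeight eta *
      (f eta * cubeGen (fun zeta => ln (f zeta)) eta).

(** Minus the derivative of [cubeDirichlet] along the semigroup. *)
Definition cubeBochner f : R :=
  \sum_(eta : config L) cubeWeight eta *
    (cubeGen f eta *
      (cubeGen (fun zeta => ln (f zeta)) eta + cubeGen f eta / f eta)).

Lemma cubeDirichletE f :
  cubeDirichlet f = (2 * L%:R)^-1 * \sum_(xi : config L) cubeWeight xi * addForm f xi.
Proof.
have -> : cubeDirichlet f = L%:R^-1 *
    \sum_(eta : config L) \sum_(x | eta x) \sum_(y | ~~ eta y)
      cubeWeight eta * lambda x *
        (f eta * (ln (f eta) - ln (f (flip y (flip x eta))))).
  rewrite /cubeDirichlet /cubeGen -sumrN mulr_sumr; apply: eq_bigr => eta _.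
  rewrite !mulr_sumr -sumrN; apply: eq_bigr => x _.
  rewrite !mulr_sumr -sumrN; apply: eq_bigr => y _; ring.
rewrite (@sum_jumps
  (fun eta zeta => f eta * (ln (f eta) - ln (f zeta)))); last first.
  by move=> zeta; rewrite subrr mulr0.
rewrite invfM -mulrA [RHS]mulrCA; congr (_ * _); rewrite mulr_sumr.
apply: eq_bigr => xi _; rewrite [RHS]mulrCA; congr (_ * _).
set X := (LHS); have half : X = 2^-1 * (X + X) by field.
rewrite half {2}/X exchange_big /X -big_split/=; congr (_ * _).
apply: eq_bigr => x _; rewrite -big_split; apply: eq_bigr => y _ /=.
by rewrite /jeffreys; ring.
Qed.

Lemma cubeBochnerE f : (forall eta, 0 < f eta) ->
  cubeBochner f = - (L%:R^-1 * \sum_(xi : config L) cubeWeight xi *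
    \sum_(x | ~~ xi x) \sum_(y | ~~ xi y)
      jeffreysD (f (flip x xi)) (f (flip y xi)) * cubeGen f (flip x xi)).
Proof.
move=> f0.
rewrite -(@sum_jumps
  (fun eta zeta => jeffreysD (f eta) (f zeta) * cubeGen f eta)); last first.
  by move=> zeta; rewrite jeffreysD_diag ?mul0r.
rewrite /cubeBochner -mulrN -sumrN mulr_sumr; apply: eq_bigr => eta _.
have -> : cubeGen (fun zeta => ln (f zeta)) eta + cubeGen f eta / f eta =
    - (L%:R^-1 * \sum_(x | eta x) \sum_(y | ~~ eta y)
         lambda x * jeffreysD (f eta) (f (flip y (flip x eta)))).
  rewrite /cubeGen -mulrA -mulrDr -mulrN; congr (_ * _).
  rewrite mulr_suml -big_split/= -sumrN; apply: eq_bigr => x _.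
  rewrite mulr_suml -big_split/= -sumrN; apply: eq_bigr => y _.
  by rewrite /jeffreysD; field; rewrite gt_eqF.
rewrite !mulrN; congr (- _); set S := (\sum_(x | eta x) _ in LHS).
transitivity (L%:R^-1 * (cubeWeight eta * (cubeGen f eta * S))); first by ring.
congr (_ * _); rewrite !mulr_sumr; apply: eq_bigr => x _.
by rewrite !mulr_sumr; apply: eq_bigr => y _; ring.
Qed.

Lemma cubeGen_flip f xi x : (0 < L)%N -> ~~ xi x ->
  L%:R * cubeGen f (flip x xi) =
  lambda x * \sum_(v | ~~ xi v) (f (flip v xi) - f (flip x xi)) +
  \sum_(u | xi u) lambda u * \sum_(v | ~~ xi v && (v != x))
     (f (flip x (flip v (flip u xi))) - f (flip x xi)).
Proof.
move=> L0 xx; rewrite /cubeGen mulrA divff ?pnatr_eq0 -?lt0n// mul1r.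
rewrite (bigD1 x) ?flip_self//=; congr (_ + _).
  rewrite sum_holes_flip// -mulr_sumr flipK; congr (_ * _).
  by rewrite (@sum_offdiag _ _ (fun v => f (flip v xi) - f (flip x xi))) ?subrr.
apply: eq_big => [u|u _].
  have [->|ux] := eqVneq u x; first by rewrite (negbTE xx) andbF.
  by rewrite flip_neq// andbT.
rewrite sum_holes_flip// -mulr_sumr; congr (_ * _); apply: eq_bigr => v _.
by rewrite (flipC u) (flipC v).
Qed.

Definition addFormBut f xi u : R :=
  pairForm (fun x => ~~ xi x && (x != u)) (fun x => f (flip x xi)).

(** With the particle [u] removed from [xi], the sum becomes antisymmetric in
    [u] and [v]. *)
Lemma parallel_moves_cancel f :
  \sum_(xi : config L) cubeWeight xi *
    (\sum_(u | xi u) lambda u * \sum_(v | ~~ xi v)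
    (addFormBut f (flip v (flip u xi)) u - addFormBut f xi v)) = 0.
Proof.
under eq_bigr do rewrite mulr_sumr; under eq_bigr do under eq_bigr do rewrite mulrA.
rewrite (sum_particles (fun xi u => \sum_(v | ~~ xi v)
    (addFormBut f (flip v (flip u xi)) u - addFormBut f xi v))).
apply: big1 => xi _; rewrite -mulr_sumr [X in _ * X](_ : _ = 0) ?mulr0//.
transitivity (\sum_(u | ~~ xi u) \sum_(v | ~~ xi v)
    (addFormBut f (flip v xi) u - addFormBut f (flip u xi) v)).
  apply: eq_bigr => u uu; rewrite sum_holes_flip//; under eq_bigr do rewrite flipK.
  by rewrite (@sum_offdiag _ _ (fun v =>
      addFormBut f (flip v xi) u - addFormBut f (flip u xi) v)) ?subrr.
under eq_bigr do rewrite sumrB.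
by rewrite sumrB exchange_big subrr.
Qed.

(** The jump of [u] to the site [v = y] is separated from the others, since it
    is coupled with the jump to [x] of the other member of the pair. *)
Lemma jeffreysD_cubeGen f xi x y : (forall eta, 0 < f eta) -> (0 < L)%N ->
  ~~ xi x -> ~~ xi y ->
  let g := jeffreysD (f (flip x xi)) (f (flip y xi)) in
  g * (L%:R * cubeGen f (flip x xi)) =
  g * (lambda x * \sum_(v | ~~ xi v) (f (flip v xi) - f (flip x xi))) +
  \sum_(u | xi u) lambda u *
    (g * (f (flip x (flip y (flip u xi))) - f (flip x xi)) +
     \sum_(v | [&& ~~ xi v, x != v & y != v])
        g * (f (flip x (flip v (flip u xi))) - f (flip x xi))).
Proof.
move=> f0 L0 xx yy g; rewrite cubeGen_flip// mulrDr; congr (_ + _).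
rewrite mulr_sumr; apply: eq_bigr => u uu; rewrite mulrCA; congr (_ * _).
have [xy|xy] := eqVneq x y.
  rewrite {}/g -xy jeffreysD_diag// !mul0r add0r big1// => v _; exact: mul0r.
rewrite (bigD1 y) ?yy 1?eq_sym//= mulrDr; congr (_ + _).
rewrite mulr_sumr; apply: eq_bigl => v.
by rewrite -andbA (eq_sym x) (eq_sym y).
Qed.

(** The three couplings are the terms [one], [merge] and [par].  In [merge] the
    two configurations become equal; in [par] they become
    [zeta + x] and [zeta + y], where [zeta] is [xi] with [u] moved to [v]. *)
Lemma coupled_generator_le f xi (c delta : R) :
  (forall eta, 0 < f eta) -> (0 < L)%N -> 0 <= delta -> 0 <= c ->
  (forall x, c <= lambda x <= c + delta) ->
  L%:R * (\sum_(x | ~~ xi x) \sum_(y | ~~ xi y)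
      jeffreysD (f (flip x xi)) (f (flip y xi)) * cubeGen f (flip x xi)) <=
  - ((c - delta) / 2 * L%:R * addForm f xi) +
  2^-1 * (\sum_(u | xi u) lambda u * \sum_(v | ~~ xi v)
    (addFormBut f (flip v (flip u xi)) u - addFormBut f xi v)).
Proof.
move=> f0 L0 d0 c0 lamb.
have aF0 x : 0 < f (flip x xi) by [].
pose g x y := jeffreysD (f (flip x xi)) (f (flip y xi)).
pose merge u := \sum_(x | ~~ xi x) \sum_(y | ~~ xi y)
   g x y * (f (flip x (flip y (flip u xi))) - f (flip x xi)).
pose par u v := \sum_(x | ~~ xi x && (x != v)) \sum_(y | ~~ xi y && (y != v))
   g x y * (f (flip x (flip v (flip u xi))) - f (flip x xi)).
pose one := \sum_(x | ~~ xi x) \sum_(y | ~~ xi y)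
   g x y * (lambda x * \sum_(v | ~~ xi v) (f (flip v xi) - f (flip x xi))).
have -> : L%:R * (\sum_(x | ~~ xi x) \sum_(y | ~~ xi y)
      jeffreysD (f (flip x xi)) (f (flip y xi)) * cubeGen f (flip x xi)) =
   one + \sum_(u | xi u) lambda u * (merge u + \sum_(v | ~~ xi v) par u v).
  transitivity (\sum_(x | ~~ xi x) \sum_(y | ~~ xi y)
     (g x y * (lambda x * \sum_(v | ~~ xi v) (f (flip v xi) - f (flip x xi))) +
      \sum_(u | xi u) lambda u *
        (g x y * (f (flip x (flip y (flip u xi))) - f (flip x xi)) +
         \sum_(v | [&& ~~ xi v, x != v & y != v])
            g x y * (f (flip x (flip v (flip u xi))) - f (flip x xi))))).
    rewrite mulr_sumr; apply: eq_bigr => x xx; rewrite mulr_sumr.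
    by apply: eq_bigr => y yy; rewrite mulrCA; exact: jeffreysD_cubeGen.
  under eq_bigr do rewrite big_split/=; rewrite big_split/=; congr (_ + _).
  under eq_bigr do rewrite exchange_big/=; rewrite exchange_big/=.
  apply: eq_bigr => u _; under eq_bigr do rewrite -mulr_sumr.
  rewrite -mulr_sumr; congr (_ * _).
  under [LHS]eq_bigr do rewrite big_split/=.
  rewrite big_split/=; congr (_ + _).
  transitivity (\sum_(x | ~~ xi x) \sum_(v | ~~ xi v && (x != v))
      \sum_(y | ~~ xi y && (y != v))
        g x y * (f (flip x (flip v (flip u xi))) - f (flip x xi))).
    apply: eq_bigr => x _.
    rewrite (exchange_big_dep (fun v => ~~ xi v && (x != v)))/=; last first.
      by move=> y v _ /and3P[-> ->].
    by apply: eq_bigr => v /andP[vv xv]; apply: eq_bigl => y; rewrite vv xv.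
  rewrite (exchange_big_dep (fun v => ~~ xi v))/=; last by move=> x v _ /andP[].
  by apply: eq_bigr => v vv; apply: eq_bigl => x; rewrite vv.
have oneE : one <= - ((c - delta) / 2 * (\sum_(x | ~~ xi x) 1) * addForm f xi).
  exact: (@one_particle_le R _ (fun x => ~~ xi x) (fun x => f (flip x xi)) lambda).
have mergeE u : merge u <= - (2^-1 * addForm f xi).
  have := @coupling_le R _ (fun x => ~~ xi x) (fun x => f (flip x xi))
    (fun x y => f (flip x (flip y (flip u xi)))) aF0 (fun _ _ => f0 _).
  rewrite [X in _ * (X - _)]big1 ?sub0r ?mulrN// => x _; rewrite big1// => y _.
  by rewrite flipC jeffreys_diag.
have parE u v : xi u -> ~~ xi v ->
    par u v <= 2^-1 * (addFormBut f (flip v (flip u xi)) u - addFormBut f xi v).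
  move=> uu vv.
  have := @coupling_le R _ (fun x => ~~ xi x && (x != v)) (fun x => f (flip x xi))
    (fun x y => f (flip x (flip v (flip u xi)))) aF0 (fun _ _ => f0 _).
  have PE : (fun x => ~~ xi x && (x != v)) =1
     (fun x => ~~ flip v (flip u xi) x && (x != u)).
    have uv : u != v by apply/eqP => uv; rewrite -uv uu in vv.
    move=> x; have [->|xv] := eqVneq x v.
      by rewrite flip_self flip_neq 1?eq_sym// vv andbF.
    rewrite flip_neq// andbT; have [->|xu] := eqVneq x u.
      by rewrite uu andbF.
    by rewrite flip_neq// andbT.
  have -> : addFormBut f (flip v (flip u xi)) u =
      \sum_(x | ~~ xi x && (x != v)) \sum_(y | ~~ xi y && (y != v))
        jeffreys (f (flip x (flip v (flip u xi)))) (f (flip y (flip v (flip u xi)))).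
    rewrite /addFormBut /pairForm; apply/esym.
    by apply: eq_big => [|x _]; [exact: PE|apply: eq_bigl; exact: PE].
  exact: id.
have SF0 : 0 <= addForm f xi by exact: pairForm_ge0.
have cardE : (\sum_(x | ~~ xi x) 1) + (\sum_(x | xi x) 1) = L%:R :> R.
  have : \sum_(x < L) 1 = L%:R :> R by rewrite sumr_const card_ord.
  by rewrite (bigID xi)/= addrC.
have sumE : \sum_(u | xi u) lambda u * (merge u + \sum_(v | ~~ xi v) par u v) <=
   \sum_(u | xi u) (- ((c - delta) / 2 * addForm f xi) +
     2^-1 * (lambda u * \sum_(v | ~~ xi v)
       (addFormBut f (flip v (flip u xi)) u - addFormBut f xi v))).
  apply: ler_sum => u uu; rewrite mulrDr; apply: lerD.
    apply: le_trans (ler_wpM2l (ltW (lambda_gt0 u)) (mergeE u)) _.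
    rewrite mulrN lerN2 -mulrA; apply: ler_wpM2r; first by rewrite mulr_ge0 ?invr_ge0.
    by have /andP[+ _] := lamb u; lra.
  rewrite mulrCA; apply: ler_wpM2l; first exact: ltW.
  by rewrite mulr_sumr; apply: ler_sum => v vv; exact: parE.
apply: le_trans (lerD oneE sumE) _.
rewrite big_split/= -mulr_sumr -cardE.
have -> : \sum_(u | xi u) - ((c - delta) / 2 * addForm f xi) =
    - ((c - delta) / 2 * (\sum_(u | xi u) 1) * addForm f xi).
  by rewrite !sumr_const -mulr_natr; ring.
by rewrite addrA lerD2r; lra.
Qed.

Theorem cube_bochner f (c delta : R) : (forall eta, 0 < f eta) -> (0 < L)%N ->
  0 <= delta -> 0 <= c -> (forall x, c <= lambda x <= c + delta) ->
  (c - delta) * cubeDirichlet f <= cubeBochner f.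
Proof.
move=> f0 L0 d0 c0 lamb; rewrite cubeDirichletE cubeBochnerE//.
have Lr : 0 < L%:R :> R by rewrite ltr0n.
set S := \sum_(xi : config L) cubeWeight xi * addForm f xi.
set B := (X in - (_ * X)).
have le1 : L%:R * B <= - ((c - delta) / 2 * L%:R * S).
  pose Z xi := \sum_(u | xi u) lambda u * \sum_(v | ~~ xi v)
    (addFormBut f (flip v (flip u xi)) u - addFormBut f xi v).
  apply: (@le_trans _ _ (\sum_(xi : config L)
     (- ((c - delta) / 2 * L%:R * (cubeWeight xi * addForm f xi))
      + 2^-1 * (cubeWeight xi * Z xi)))).
    rewrite mulr_sumr; apply: ler_sum => xi _; rewrite mulrCA.
    apply: le_trans (ler_wpM2l (ltW (cubeWeight_gt0 xi))
      (coupled_generator_le xi f0 L0 d0 c0 lamb)) _.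
    by rewrite -/(Z xi); lra.
  rewrite big_split/= -mulr_sumr parallel_moves_cancel mulr0 addr0.
  by rewrite sumrN -mulr_sumr.
have := ler_wpM2l (sqr_ge0 L%:R^-1) le1.
have -> : L%:R^-1 ^+ 2 * (L%:R * B) = L%:R^-1 * B by field; rewrite gt_eqF.
have -> : L%:R^-1 ^+ 2 * - ((c - delta) / 2 * L%:R * S) =
    - ((c - delta) * ((2 * L%:R)^-1 * S)) by field; rewrite gt_eqF.
lra.
Qed.

End Cube.

(** * The Bernoulli-Laplace process with a fixed number of particles *)

Section FixedParticleNumber.
Context {R : realType} {L N : nat}.
Variable lambda : 'I_L -> R.
Hypothesis lambda_gt0 : forall x, 0 < lambda x.
Local Notation S_N := (stateSpace L N).
Implicit Types (s : S_N) (f g : S_N -> R) (eta : config L).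

(** On the other sectors the constant value 1 is positive and its logarithm
    extends [ln f] by a constant as well. *)
Definition extend f eta : R := oapp f 1 (insub eta : option S_N).

Lemma extend_val f s : extend f (val s) = f s.
Proof. by rewrite /extend valK. Qed.

Lemma extend_out f eta : particles eta != N -> extend f eta = 1.
Proof. by move=> etaN; rewrite /extend insubN. Qed.

Lemma extend_gt0 f : (forall s, 0 < f s) -> forall eta, 0 < extend f eta.
Proof.
move=> f0 eta; rewrite /extend; case: insubP => *; [exact: f0|exact: ltr01].
Qed.

Lemma sum_sector (G : config L -> R) :
  (forall eta, particles eta != N -> G eta = 0) ->
  \sum_(eta : config L) G eta = \sum_(s : S_N) G (val s).
Proof.
move=> G0; rewrite (bigID (fun eta => particles eta == N))/= [X in _ + X]big1//.
rewrite addr0 (reindex_omap (val : S_N -> config L) insub)/=; last first.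
  by move=> eta etaN; rewrite insubT.
by apply: eq_bigl => s; rewrite (valP s) valK eqxx.
Qed.

Lemma generator_cubeGen (h : config L -> R) g s :
  (forall s', h (val s') = g s') ->
  generator lambda g s = cubeGen lambda h (val s).
Proof.
move=> hg; rewrite /generator /cubeGen; congr (_ * _).
rewrite [RHS]big_mkcond; apply: eq_bigr => x _; rewrite /occ.
case: ifP => sx; last by rewrite big1// => y _; rewrite mulr0 !mul0r.
rewrite [RHS]big_mkcond; apply: eq_bigr => y _.
case: ifP => sy; last by rewrite (negbFE sy) subrr mulr0 mul0r.
rewrite (negbTE sy) subr0 !mulr1 /grad -!hg/=.
by rewrite exchange_flip.
Qed.

Lemma cubeGen_out f eta : particles eta != N ->
  cubeGen lambda (extend f) eta = 0.
Proof.
move=> etaN; rewrite /cubeGen big1 ?mulr0// => x ex; rewrite big1// => y ey.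
rewrite -exchange_flip// !extend_out ?particles_exchange//.
by rewrite subrr mulr0.
Qed.

Local Notation Z := (partition_function N lambda).

Lemma dirichlet_form_cube f : (forall s, 0 < f s) ->
  dirichlet_form lambda f (fun s => ln (f s)) =
  Z^-1 * cubeDirichlet lambda (extend f).
Proof.
move=> f0; rewrite /dirichlet_form /cubeDirichlet mulrN; congr (- _).
rewrite sum_sector; last first.
  move=> eta etaN; rewrite /cubeGen big1 ?mulr0 ?mulr0// => x ex.
  rewrite big1// => y ey.
  rewrite -exchange_flip// !extend_out ?particles_exchange//.
  by rewrite subrr mulr0.
rewrite /pi_expect mulr_sumr; apply: eq_bigr => s _; rewrite /pi_N -mulrA.
rewrite extend_val -(@generator_cubeGen _ (fun s => ln (f s)))// => s'.
by rewrite extend_val.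
Qed.

Lemma bochner_cube f :
  pi_expect lambda (fun s => generator lambda f s
     * generator lambda (fun s' => ln (f s')) s)
  + pi_expect lambda (fun s => generator lambda f s ^+ 2 / f s) =
  Z^-1 * cubeBochner lambda (extend f).
Proof.
rewrite /cubeBochner sum_sector; last first.
  by move=> eta etaN; rewrite cubeGen_out// mul0r mulr0.
rewrite /pi_expect -big_split mulr_sumr; apply: eq_bigr => s _ /=.
rewrite -(@generator_cubeGen (fun zeta => ln (extend f zeta))
  (fun s => ln (f s))); last first.
  by move=> s'; rewrite extend_val.
rewrite -(@generator_cubeGen _ f); last exact: extend_val.
by rewrite extend_val /pi_N -[weight _ _]/(cubeWeight lambda (val s)); ring.
Qed.

Lemma stateSpace_witness : (N <= L)%N ->
  particles ([ffun x : 'I_L => (x < N)%N] : config L) == N.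
Proof.
move=> NL; apply/eqP; rewrite /particles.
under eq_bigr do rewrite ffunE.
rewrite (eq_bigr (fun x : 'I_L => if (x < N)%N then 1%N else 0%N)); last first.
  by move=> x _; case: (_ < _)%N.
by rewrite -big_mkcond -(big_ord_widen L (fun=> 1%N))// sum1_card card_ord.
Qed.

Lemma partition_function_gt0 : (N <= L)%N -> 0 < Z.
Proof.
move=> NL; rewrite /partition_function.
pose s0 : S_N := exist (fun eta : config L => particles eta == N) _
  (stateSpace_witness NL).
rewrite (bigD1 s0)//= ltr_pwDl//.
  exact: cubeWeight_gt0.
by apply: sumr_ge0 => s _; exact/ltW/cubeWeight_gt0.
Qed.

Lemma pi_N_gt0 s : (N <= L)%N -> 0 < pi_N lambda s.
Proof.
move=> NL; apply: mulr_gt0; last exact: cubeWeight_gt0.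
by rewrite invr_gt0 partition_function_gt0.
Qed.

Lemma pi_N_sum1 : (N <= L)%N -> \sum_(s : S_N) pi_N lambda s = 1.
Proof.
by move=> NL; rewrite -mulr_sumr mulVf// gt_eqF// partition_function_gt0.
Qed.

Definition jump s (m : 'I_L * 'I_L) : S_N := exchangeS s m.1 m.2.

Definition jumpRate s (m : 'I_L * 'I_L) : R :=
  L%:R^-1 * (lambda m.1 * (occ s m.1)%:R * (1 - (occ s m.2)%:R)).

Lemma jumpRate_ge0 s m : 0 <= jumpRate s m.
Proof.
rewrite /jumpRate mulr_ge0 ?invr_ge0// mulr_ge0 ?mulr_ge0//; first exact: ltW.
by rewrite /occ; case: (val s _); rewrite ?subrr ?subr0.
Qed.

Lemma chainGen_generator f s : chainGen jump jumpRate f s = generator lambda f s.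
Proof.
rewrite /chainGen /generator mulr_sumr.
under [RHS]eq_bigr do rewrite mulr_sumr.
rewrite pair_bigA; apply: eq_bigr => -[x y] _ /=.
exact/esym/mulrA.
Qed.

(** The diagonal is set to zero to meet the condition of [sum_jumps]; no jump
    has equal end points. *)
Definition extend2 (F : S_N -> S_N -> R) eta zeta : R :=
  if eta == zeta then 0 else
  if insub eta is Some s then
    if insub zeta is Some s' then F s s' else 0
  else 0.

Lemma sum_jump_cube (F : S_N -> S_N -> R) :
  \sum_(s : S_N) \sum_m pi_N lambda s * jumpRate s m * F s (jump s m) =
  Z^-1 * L%:R^-1 * \sum_(eta : config L) \sum_(x | eta x) \sum_(y | ~~ eta y)
     cubeWeight lambda eta * lambda x * extend2 F eta (flip y (flip x eta)).
Proof.
rewrite sum_sector; last first.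
  move=> eta etaN; rewrite big1// => x _; rewrite big1// => y _.
  by rewrite /extend2 insubN//; case: ifP; rewrite mulr0.
rewrite mulr_sumr; apply: eq_bigr => s _.
rewrite -(pair_bigA _ (fun x y =>
  pi_N lambda s * jumpRate s (x, y) * F s (jump s (x, y))))/=.
rewrite mulr_sumr [RHS]big_mkcond; apply: eq_bigr => x _.
rewrite /jumpRate /occ/=; case: ifP => sx; last first.
  by rewrite big1// => y _; rewrite !(mulr0, mul0r).
rewrite mulr_sumr [RHS]big_mkcond; apply: eq_bigr => y _.
case: ifP => sy; last by rewrite (negbFE sy) subrr !(mulr0, mul0r).
rewrite -exchange_flip// /extend2.
have -> : val s == exchange (val s) x y = false.
  apply/negbTE/eqP => /(congr1 (fun e : config L => e x)).
  by rewrite /exchange sx sy ffunE eqxx.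
rewrite valK -[exchange _ _ _]/(val (jump s (x, y))) valK.
rewrite (negbTE sy) subr0 !mulr1 /pi_N.
rewrite -[weight _ _]/(cubeWeight lambda (val s)).
by ring.
Qed.

Lemma jump_reversible (F : S_N -> S_N -> R) :
  \sum_(s : S_N) \sum_m pi_N lambda s * jumpRate s m * F s (jump s m) =
  \sum_(s : S_N) \sum_m pi_N lambda s * jumpRate s m * F (jump s m) s.
Proof.
have diag G eta : extend2 G eta eta = 0 by rewrite /extend2 eqxx.
rewrite (sum_jump_cube F) (sum_jump_cube (fun s s' => F s' s)) !sum_jumps//.
congr (_ * _); apply: eq_bigr => xi _; rewrite exchange_big/=; congr (_ * _).
apply: eq_bigr => x _; apply: eq_bigr => y _.
rewrite /extend2 eq_sym; case: ifP => // _.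
by case: insubP => [? _ _|_]; case: insubP.
Qed.

End FixedParticleNumber.

(** Two configurations with equal particle numbers that differ have a site
    occupied only in the first and a site occupied only in the second; an
    exchange between them reduces the number of disagreements. *)
Lemma exchange_connected (L N : nat) (T : Type) (g : stateSpace L N -> T) :
  (forall (s : stateSpace L N) x y, val s x -> ~~ val s y ->
    g (exchangeS s x y) = g s) ->
  forall s s', g s = g s'.
Proof.
move=> gE s s'.
have excess (t t' : stateSpace L N) : t != t' -> exists x, val t x && ~~ val t' x.
  move=> tt'; apply/existsP; apply: contraR tt' => /existsPn le.
  have le1 x : true -> ((val t x : nat) <= val t' x ?= iff (val t x == val t' x))%N.
    by move=> _; have := le x; case: (val t x); case: (val t' x).
  have := leqif_sum le1; rewrite -/(particles _) -/(particles _).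
  move=> [_]; rewrite (eqP (valP t)) (eqP (valP t')) eqxx => /esym/forallP eqt.
  by apply/eqP/val_inj/ffunP => x; exact/eqP/(eqt x).
have [n] := ubnP #|[set z | val s z != val s' z]|.
elim: n s => // n IH s dn.
have [->//|ss'] := eqVneq s s'.
have [x /andP[sx s'x]] := excess _ _ ss'.
have [y /andP[s'y sy]] : exists y, val s' y && ~~ val s y.
  by apply: excess; rewrite eq_sym.
rewrite -(gE s x y)//; apply: IH; rewrite -ltnS; apply: leq_trans dn.
rewrite ltnS; apply: proper_card; apply/properP; split.
  apply/fintype.subsetP => z; rewrite !inE /= /exchange sx sy ffunE/=.
  have [->|zx] := eqVneq z x; first by rewrite sx s'x.
  by have [->|//] := eqVneq z y; rewrite s'y.
by exists x; rewrite !inE/= (negbTE s'x) ?sx// /exchange sx sy ffunE eqxx.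
Qed.

Theorem theorem5p1 (R : realType) (L : nat) (hL : (1 <= L)%N)
  (lambda : 'I_L -> R) (hlambda : forall x : 'I_L, 0 < lambda x)
  (c delta : R) (hdelta : 0 <= delta) (hc : delta < c)
  (hbounds : forall x : 'I_L, c <= lambda x /\ lambda x <= c + delta)
  (N : nat) (hN : (N <= L)%N)
  (f : stateSpace L N -> R) (hf : forall eta : stateSpace L N, 0 < f eta) :
  ((c - delta) * dirichlet_form lambda f (fun eta => ln (f eta))
     <= pi_expect lambda (fun eta =>
          generator lambda f eta
          * generator lambda (fun eta' => ln (f eta')) eta)
        + pi_expect lambda (fun eta => generator lambda f eta ^+ 2 / f eta))
  /\ ((c - delta) * entropy lambda f
        <= dirichlet_form lambda f (fun eta => ln (f eta))).
Proof.
have bochner (g : stateSpace L N -> R) : (forall s, 0 < g s) ->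
  (c - delta) * dirichlet_form lambda g (fun s => ln (g s))
     <= pi_expect lambda (fun s => generator lambda g s
          * generator lambda (fun s' => ln (g s')) s)
        + pi_expect lambda (fun s => generator lambda g s ^+ 2 / g s).
  move=> g0; rewrite dirichlet_form_cube// bochner_cube mulrCA.
  apply: ler_wpM2l; first by rewrite invr_ge0 ltW// partition_function_gt0.
  apply: cube_bochner => //; first exact: extend_gt0.
    exact: le_trans (ltW hc).
  by move=> x; apply/andP; exact: hbounds.
split; first exact: bochner.
have genE g s := chainGen_generator lambda g s.
have dirE (g : stateSpace L N -> R) :
    chainDirichlet (@jump L N) (jumpRate lambda) (pi_N lambda) g =
    dirichlet_form lambda g (fun s => ln (g s)).
  by congr (- _); apply: eq_bigr => s _; rewrite genE.
rewrite -dirE; apply: mlsi_of_bochner => //.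
- by move=> s; exact: pi_N_gt0.
- exact: pi_N_sum1.
- exact: jumpRate_ge0.
- exact: jump_reversible.
- move=> g gE; apply: exchange_connected => s x y sx sy.
  apply: (gE s (x, y)); rewrite /jumpRate /occ/= sx (negbTE sy) subr0 !mulr1.
  by rewrite mulr_gt0// invr_gt0 ltr0n.
- by rewrite subr_ge0 ltW.
- move=> g g0; rewrite dirE; apply: le_trans (bochner g g0) _.
  rewrite /pi_expect -big_split -sumrN/=; apply: ler_sum => s _.
  rewrite le_eqVlt; apply/orP; left; apply/eqP.
  rewrite /dirichletGrad !genE.
  by field; rewrite gt_eqF.
Qed.
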